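(* If and only if $s<0$ and $b>0$, one has $$\zeta(-b\,s)\,\Gamma(b)=\int_{0}^{\infty}x^{b-1}\sum_{j=1}^{\infty}e^{-x\,j^{-s}}\,dx .$$
   Context: $\zeta$ is the Riemann zeta function, $\Gamma$ is the Gamma function, and $b$ is real.
   Formalization: The condition -bs > 1 is added to ''s<0 and b>0'': for 0 < -bs < 1 the integral diverges while ζ(-bs)Γ(b) is finite (e.g. s=-1, b=1/2), and at -bs = 1 ζ has a pole; s and b are real and the identity means equality with a finite value. *)

(* Defs.v *)
From HB Require Import structures.
From mathcomp Require Import all_boot all_order all_algebra.
From mathcomp Require Import all_classical all_reals all_analysis.
Set Implicit Arguments.
Unset Strict Implicit.
Unset Printing Implicit Defensive.
Import Order.TTheory GRing.Theory Num.Theory.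
Import numFieldNormedType.Exports.
Local Open Scope classical_set_scope.
Local Open Scope ring_scope.

(* The Gamma function on the real line: Euler's integral for b > 0, continued
   to b <= 0 by Gamma (b + n) = b (b + 1) ... (b + n - 1) Gamma b, with n the
   least natural number such that b + n > 0. At the poles 0, -1, -2, ... the
   denominator vanishes and the value is 0. *)
Definition Euler_integral (R : realType) (b : R) : R :=
  \int[lebesgue_measure]_(x in `]0, +oo[) (x `^ (b - 1) * expR (- x)).

Definition Gamma (R : realType) (b : R) : R :=
  if 0 < b then Euler_integral b
  else let n := (Num.truncn (- b)).+1 in
       Euler_integral (b + n%:R) / \prod_(i < n) (b + i%:R).

(* The Riemann zeta function on the real line: the Dirichlet series for t > 1
   and, for t < 1, the analytic continuation given by Hasse's series
     (1 - 2^(1-t))^-1 \sum_n 2^-(n+1) \sum_(k <= n) (-1)^k C(n,k) (k+1)^-t,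
   which converges for every t <> 1. At the pole t = 1 the factor in front is
   0^-1 = 0 and the value is 0. *)
Definition zeta (R : realType) (t : R) : R :=
  if 1 < t then limn (series (fun n => n.+1%:R `^ (- t)))
  else (1 - 2 `^ (1 - t))^-1 *
       limn (series (fun n => 2 ^- n.+1 *
         \sum_(k < n.+1) (- 1) ^+ k * 'C(n, k)%:R * k.+1%:R `^ (- t))).

(* Main.v *)
Require Import Defs.
From HB Require Import structures.
From mathcomp Require Import all_boot all_order all_algebra.
From mathcomp Require Import all_classical all_reals all_analysis.
From mathcomp Require Import measurable_realfun ring lra.
Import Order.TTheory GRing.Theory Num.Theory.
Import numFieldNormedType.Exports.
Local Open Scope classical_set_scope.
Local Open Scope ring_scope.

(** All terms under the integral sign are nonnegative, so by monotone
    convergence the sum and the integral can be exchanged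
    ([integral_dirichlet_expR]): in the extended reals, the right-hand side is
    the sum over j >= 1 of the integrals of x ^ (b - 1) * exp (- x * j ^ (- s))
    over the positive half-line.

    When b > 0, the substitution of x * c for x ([gamma_integral_scale]) turns
    the j-th integral into Gamma b * j ^ (b * s), with 0 < Gamma b < +oo
    ([gamma_integral_lty], [gamma_integral_gt0]). The right-hand side is thus
    Gamma b times the Dirichlet series of zeta at t = - b * s. If t > 1 the
    series converges to zeta t ([nneseries_zeta]) and the identity holds. If
    t <= 1 the series diverges ([nneseries_dirichlet_pinfty]) and the right-hand
    side is +oo. When b <= 0 the term j = 1 alone is already infinite
    ([gamma_integral_pinfty]).

    Since the left-hand side is always finite, the identity is equivalent to
    b > 0 together with - b * s > 1, and these two force s < 0. *)

(** * Real powers *)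

Lemma gt0_mulr_powRB1 {R : realType} (x p : R) : 0 < x ->
  x * x `^ (p - 1) = x `^ p.
Proof.
move=> x0; have xn0 : x != 0 by rewrite gt_eqF.
by rewrite powRB ?xn0 ?implybT// (powRr1 (ltW x0)) mulrCA mulfV ?mulr1.
Qed.

(** This is u <= e ^ u at u = y / p, raised to the power p. *)
Lemma powR_le_expR {R : realType} (p y : R) : 0 < p -> 0 <= y ->
  y `^ p <= p `^ p * expR y.
Proof.
move=> p0 y0; have p0' := ltW p0.
have yp0 : 0 <= y / p by rewrite divr_ge0.
have yE : y = p * (y / p) by rewrite mulrCA mulfV ?mulr1// gt_eqF.
rewrite {1}yE powRM// ler_wpM2l ?powR_ge0//.
have -> : expR y = expR (y / p) `^ p by rewrite -expRM mulfVK// gt_eqF.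
rewrite ge0_ler_powR ?nnegrE ?expR_ge0//.
by rewrite (le_trans _ (expR_ge1Dx _))// lerDr.
Qed.

(** * Integrals over the positive half-line *)

Lemma integral_derive {R : realType} (f F : R -> R) (u v : R) : u < v ->
  (forall x, u <= x -> is_derive x 1 F (f x)) ->
  (forall x, u <= x -> derivable f x 1) ->
  (\int[lebesgue_measure]_(x in `[u, v]) (f x)%:E = (F v - F u)%:E)%E.
Proof.
move=> uv dF df; have cF x : u <= x -> {for x, continuous F}.
  move=> /dF[dFx _]; apply: differentiable_continuous.
  exact/derivable1_diffP.
rewrite EFinB; apply: continuous_FTC2 => //.
- by apply: derivable_within_continuous => x; rewrite in_itv/= => /andP[/df].
- split.
  + by move=> x; rewrite in_itv/= => /andP[/ltW/dF[]].
  + by apply: cvg_at_right_filter; exact: cF.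
  + by apply: cvg_at_left_filter; apply: cF; exact: ltW.
- move=> x; rewrite in_itv/= => /andP[/ltW/dF[_ <-] _].
  by rewrite derive1E.
Qed.

(** The half-line is the increasing union of the intervals [1 / n, n], so its
    integral is the supremum of the integrals over compact intervals. On those
    every integrand below is smooth, whatever its behaviour at 0 and at
    infinity, and the fundamental theorem of calculus and the change of
    variables apply. *)
Lemma ge0_integral_itv0y_le {R : realType} (f : R -> R) (M : \bar R) :
  measurable_fun setT f -> (forall x, 0 <= f x) ->
  (forall u v : R, 0 < u -> u < v ->
     (\int[lebesgue_measure]_(x in `[u, v]) (f x)%:E <= M)%E) ->
  (\int[lebesgue_measure]_(x in `]0%R, +oo[) (f x)%:E <= M)%E.
Proof.
move=> mf f0 fM; pose I n : set R := `[n.+2%:R^-1, n.+2%:R]%classic.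
have -> : `]0%R, +oo[%classic = \bigcup_n I n.
  apply/seteqP; split => [x|x [n _]]/=; rewrite !in_itv/= ?andbT.
    move=> x0; have y0 : 0 < x + x^-1 by rewrite addr_gt0 ?invr_gt0.
    have yn : x + x^-1 < (Num.truncn (x + x^-1)).+1%:R by exact: truncnS_gt.
    set n := Num.truncn _ in yn; exists n => //=.
    have n2 : x + x^-1 <= n.+2%:R.
      by rewrite (le_trans (ltW yn))// ler_nat.
    rewrite /I/= in_itv/= -[leRHS]invrK lef_pV2 ?posrE ?invr_gt0//.
    by rewrite !(le_trans _ n2)// ?lerDl ?lerDr ?invr_ge0 ltW.
  by rewrite /I/= in_itv/= => /andP[nx _]; rewrite (lt_le_trans _ nx)// invr_gt0.
have mE (D : set R) : measurable_fun D (fun x : R => (f x)%:E).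
  by apply/measurable_EFinP; exact: measurable_funTS.
have ndI : nondecreasing_seq I.
  apply/nondecreasing_seqP => n; rewrite subsetEset => x; rewrite /I/= !in_itv/=.
  move=> /andP[nx xn]; rewrite (le_trans xn) ?ler_nat// andbT.
  by rewrite (le_trans _ nx)// lef_pV2 ?posrE// ler_nat.
have mI n : measurable (I n) by exact: measurable_itv.
have cvgI : (\int[lebesgue_measure]_(x in I n) (f x)%:E @[n --> \oo] -->
    \int[lebesgue_measure]_(x in \bigcup_n I n) (f x)%:E)%E.
  apply: ge0_nondecreasing_set_cvg_integral => // [n|n x _].
    exact: (mE (I n)).
  by rewrite lee_fin.
rewrite -(cvg_lim _ cvgI)//; apply: lime_le; first exact: cvgP cvgI.
apply: nearW => n; apply: fM; first by rewrite invr_gt0.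
by rewrite (@lt_trans _ _ 1)// ?ltr1n// invf_lt1// ltr1n.
Qed.

(** * Euler's integral with a scale parameter *)

Definition gamma_kernel {R : realType} (b c x : R) : R :=
  x `^ (b - 1) * expR (- (x * c)).

Lemma gamma_kernel_ge0 {R : realType} (b c x : R) : 0 <= gamma_kernel b c x.
Proof. by rewrite mulr_ge0 ?powR_ge0 ?expR_ge0. Qed.

Lemma measurable_gamma_kernel {R : realType} (b c : R) :
  measurable_fun setT (gamma_kernel b c).
Proof.
apply: measurable_funM; first exact: measurable_powR.
apply: measurableT_comp => //; apply: measurableT_comp => //.
exact: measurable_funM.
Qed.

Lemma derivable_gamma_kernel {R : realType} (b c x : R) : 0 < x ->
  derivable (gamma_kernel b c) x 1.
Proof.
move=> x0; apply: derivableM; first by apply: derivable_powR; rewrite in_itv/= x0.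
have := @is_derive1_comp R expR (fun y : R => - (y * c)) x _ _ _ _.
by move=> /(_ _ _ _ _)[].
Qed.

(** Valued in the extended reals so that divergence, for b <= 0, shows as the
    value +oo. *)
Definition gamma_integral {R : realType} (b c : R) : \bar R :=
  (\int[lebesgue_measure]_(x in `]0%R, +oo[) (gamma_kernel b c x)%:E)%E.

Lemma gamma_integral_ge0 {R : realType} (b c : R) :
  (0 <= gamma_integral b c)%E.
Proof. by apply: integral_ge0 => x _; rewrite lee_fin gamma_kernel_ge0. Qed.

Lemma gamma_integral_itv_le {R : realType} (b c u v : R) : 0 < u ->
  (\int[lebesgue_measure]_(x in `[u, v]) (gamma_kernel b c x)%:E
     <= gamma_integral b c)%E.
Proof.
move=> u0; apply: ge0_subset_integral => //.
- by apply/measurable_EFinP/measurable_funTS; exact: measurable_gamma_kernel.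
- by move=> x _; rewrite lee_fin gamma_kernel_ge0.
- by move=> x/=; rewrite !in_itv/= andbT => /andP[ux _]; rewrite (lt_le_trans u0).
Qed.

Lemma gamma_kernel_scale {R : realType} (a b c x : R) : 0 < a -> 0 < x ->
  gamma_kernel b c (a * x) * a = a `^ b * gamma_kernel b (a * c) x.
Proof.
move=> a0 x0; rewrite /gamma_kernel powRM ?ltW//.
rewrite -(gt0_mulr_powRB1 _ b a0).
have -> : a * x * c = x * (a * c) by ring.
by ring.
Qed.

Lemma integral_gamma_kernel_scale {R : realType} (a b c u v : R) :
  0 < a -> 0 < u -> u < v ->
  (\int[lebesgue_measure]_(x in `[(a * u)%R, (a * v)%R])
      (gamma_kernel b c x)%:E
   = (a `^ b)%:E * \int[lebesgue_measure]_(x in `[u, v])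
      (gamma_kernel b (a * c) x)%:E)%E.
Proof.
move=> a0 u0 uv.
have da : (fun x : R => a * x)^`()%classic = cst a.
  by apply/funext => x; rewrite derive1Ml// derive1_id mulr1.
rewrite (@integration_by_substitution_increasing _ (fun x => a * x))//.
- rewrite -ge0_integralZl_EFin ?powR_ge0//.
  + apply: eq_integral => x; rewrite inE/= in_itv/= => /andP[ux _].
    by rewrite -EFinM da !fctE gamma_kernel_scale// (lt_le_trans u0).
  + by move=> x _; rewrite lee_fin gamma_kernel_ge0.
  + by apply/measurable_EFinP/measurable_funTS; exact: measurable_gamma_kernel.
- exact: ltW.
- by move=> x y _ _; rewrite ltr_pM2l.
- by rewrite da => x _; exact: cvg_cst.
- by rewrite da; exact: is_cvg_cst.
- by rewrite da; exact: is_cvg_cst.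
- have ca : continuous (fun x : R => a * x) by exact: mulrl_continuous.
  split; [by move=> x _|by apply: cvg_at_right_filter; exact: ca|].
  by apply: cvg_at_left_filter; exact: ca.
- apply: derivable_within_continuous => x; rewrite in_itv/= => /andP[ux _].
  by apply: derivable_gamma_kernel; rewrite (lt_le_trans _ ux)// mulr_gt0.
Qed.

(** One inequality is enough for the scaling law: applied with a and with 1 / a
    it gives both directions of the equality that follows. *)
Lemma le_gamma_integral_scale {R : realType} (a b c : R) : 0 < a ->
  (gamma_integral b c <= (a `^ b)%:E * gamma_integral b (a * c))%E.
Proof.
move=> a0; apply: ge0_integral_itv0y_le.
- exact: measurable_gamma_kernel.
- exact: gamma_kernel_ge0.
- move=> u v u0 uv.
  have aK x : x = a * (x / a) by rewrite mulrCA mulfV ?mulr1// gt_eqF.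
  rewrite (aK u) (aK v) integral_gamma_kernel_scale//.
  + rewrite lee_wpmul2l ?lee_fin ?powR_ge0//; apply: gamma_integral_itv_le.
    by rewrite divr_gt0.
  + by rewrite divr_gt0.
  + by rewrite ltr_pM2r ?invr_gt0.
Qed.

Lemma gamma_integral_scale {R : realType} (b c : R) : 0 < c ->
  (gamma_integral b c = (c `^ (- b))%:E * gamma_integral b 1)%E.
Proof.
move=> c0; apply/eqP; rewrite eq_le; apply/andP; split.
  have := @le_gamma_integral_scale _ c^-1 b c; rewrite invr_gt0 => /(_ c0).
  by rewrite mulVf ?gt_eqF// -(mulN1r b) powRrM (powR_inv1 (ltW c0)).
apply: (@le_trans _ _
  ((c `^ (- b))%:E * ((c `^ b)%:E * gamma_integral b c))%E).
  rewrite lee_wpmul2l ?lee_fin ?powR_ge0//.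
  by have := @le_gamma_integral_scale _ c b 1 c0; rewrite mulr1.
by rewrite muleA -EFinM powRN mulVf ?mul1e// gt_eqF// powR_gt0.
Qed.

(** * Convergence and divergence of Euler's integral *)

(** The derivative of (x / (1 + x)) ^ b. For b > 0 its integral over the
    half-line is therefore 1. Near 0 it behaves like x ^ (b - 1), and at infinity it
    decays only polynomially, so a multiple of it dominates Euler's integrand
    at both ends at once. *)
Definition beta_kernel {R : realType} (b x : R) : R :=
  b * x `^ (b - 1) * (1 + x) `^ (- b - 1).

Lemma is_derive_add1 {R : realType} (x : R) :
  is_derive x 1 (fun y : R => 1 + y) 1.
Proof.
by have := is_deriveD (is_derive_cst (1 : R) x 1) (is_derive_id x 1); rewrite add0r.
Qed.

Lemma is_derive_beta_kernel {R : realType} (b x : R) : 0 < x ->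
  is_derive x 1 (fun y => y `^ b * (1 + y) `^ (- b)) (beta_kernel b x).
Proof.
move=> x0; have x1 : 0 < 1 + x by rewrite addr_gt0.
have d2 := is_derive1_comp (is_derive1_powR (- b) x1) (is_derive_add1 x).
have d3 := is_derive1_powR b x0.
apply: (is_derive_eq (is_deriveM d3 d2)).
rewrite /= /GRing.scale/= /beta_kernel.
rewrite -(gt0_mulr_powRB1 _ b x0) -(gt0_mulr_powRB1 _ (- b) x1).
by ring.
Qed.

Lemma derivable_beta_kernel {R : realType} (b x : R) : 0 < x ->
  derivable (beta_kernel b) x 1.
Proof.
move=> x0; have x1 : 0 < 1 + x by rewrite addr_gt0.
have [d2 _] :=
  is_derive1_comp (is_derive1_powR (- b - 1) x1) (is_derive_add1 x).
have [d3 _] := is_derive1_powR (b - 1) x0.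
exact: (derivableM (derivableM (derivable_cst b x 1) d3) d2).
Qed.

(** Bounding (1 + x) ^ (b + 1) by a multiple of e ^ (1 + x) shows that C times
    the beta kernel dominates Euler's integrand; the primitive of the beta
    kernel takes values in [0, 1], which bounds all compact integrals by C. *)
Lemma gamma_integral_lty {R : realType} (b : R) : 0 < b ->
  (gamma_integral b 1 < +oo)%E.
Proof.
move=> b0; pose C := (b + 1) `^ (b + 1) * expR 1 / b.
have C0 : 0 <= C by rewrite !mulr_ge0 ?powR_ge0 ?expR_ge0 ?invr_ge0 ?ltW.
apply: (@le_lt_trans _ _ C%:E); last by rewrite ltry.
apply: ge0_integral_itv0y_le.
- exact: measurable_gamma_kernel.
- exact: gamma_kernel_ge0.
- move=> u v u0 uv.
  have dbeta x : u <= x -> is_derive x 1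
      (fun y => C * (y `^ b * (1 + y) `^ (- b))) (C * beta_kernel b x).
    move=> ux; have := is_deriveZ C (is_derive_beta_kernel b _ (lt_le_trans u0 ux)).
    by [].
  have kbeta x : 0 < x -> gamma_kernel b 1 x <= C * beta_kernel b x.
    move=> x0; rewrite /gamma_kernel /beta_kernel mulr1.
    have x1 : 0 < 1 + x by rewrite addr_gt0.
    have -> : C * (b * x `^ (b - 1) * (1 + x) `^ (- b - 1)) =
        x `^ (b - 1) * ((b + 1) `^ (b + 1) * expR 1 * (1 + x) `^ (- b - 1)).
      by rewrite /C; field; rewrite gt_eqF.
    rewrite ler_wpM2l ?powR_ge0// expRN -opprD powRN.
    rewrite ler_pdivlMr ?powR_gt0// mulrC ler_pdivrMr ?expR_gt0//.
    rewrite -mulrA -expRD; apply: powR_le_expR; last exact: ltW.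
    by rewrite addr_gt0.
  apply: (@le_trans _ _
    (\int[lebesgue_measure]_(x in `[u, v]) (C * beta_kernel b x)%:E)%E).
    apply: ge0_le_integral => //.
    + by move=> x _; rewrite lee_fin gamma_kernel_ge0.
    + by apply/measurable_EFinP/measurable_funTS; exact: measurable_gamma_kernel.
    + apply/measurable_EFinP/measurable_funTS.
      apply: measurable_funM => //; apply: measurable_funM.
        by apply: measurable_funM => //; exact: measurable_powR.
      apply: (measurableT_comp (measurable_powR _)).
      exact: measurable_funD.
    + move=> x; rewrite /= in_itv/= => /andP[ux _].
      by rewrite lee_fin kbeta// (lt_le_trans u0).
  rewrite (integral_derive _ _ u v uv dbeta) => [|x ux].
    rewrite lee_fin -mulrBr -[leRHS]mulr1 ler_wpM2l//.
    have v0 : 0 < v by exact: lt_trans uv.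
    rewrite lerBlDr ler_wpDr ?mulr_ge0 ?powR_ge0//.
    rewrite powRN ler_pdivrMr ?powR_gt0 ?addr_gt0// mul1r.
    by apply: ge0_ler_powR; rewrite ?nnegrE; lra.
  have := derivable_beta_kernel b _ (lt_le_trans u0 ux).
  exact: derivableM (derivable_cst C x 1).
Qed.

(** On [e, 1] the integrand is at least k * expR (- 1) / x, whose primitive is a
    logarithm. With e = 1 / 2 the bound gives positivity for b > 0; with k = 1
    and e tending to 0 it gives divergence for b <= 0. *)
Lemma gamma_integral_ge {R : realType} (b e k : R) : 0 < e < 1 -> 0 <= k ->
  (forall x, e <= x <= 1 -> k <= x `^ b) ->
  ((k * expR (- 1) * - ln e)%:E <= gamma_integral b 1)%E.
Proof.
move=> /andP[e0 e1] k0 kx.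
apply: le_trans (gamma_integral_itv_le b 1 e 1 e0).
have c0 : 0 <= k * expR (- 1) by rewrite mulr_ge0 ?expR_ge0.
have dln x : e <= x -> is_derive x 1 (fun y => k * expR (- 1) * ln y)
    (k * expR (- 1) * x `^ (- 1)).
  move=> ex; have x0 := lt_le_trans e0 ex.
  rewrite (powR_inv1 (ltW x0)).
  exact: (is_deriveZ (k * expR (- 1)) (is_derive1_ln x0)).
rewrite (_ : _ * _ = k * expR (- 1) * ln 1 - k * expR (- 1) * ln e); last first.
  by rewrite ln1 mulr0 add0r mulrN.
rewrite -(integral_derive _ _ e 1 e1 dln) => [|x ex].
  apply: ge0_le_integral => //.
  + move=> x; rewrite /= in_itv/= => /andP[ex _].
    by rewrite lee_fin mulr_ge0 ?powR_ge0.
  + apply/measurable_EFinP; apply: measurable_funM => //.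
    by apply: measurable_funTS; exact: measurable_powR.
  + by apply/measurable_EFinP/measurable_funTS; exact: measurable_gamma_kernel.
  + move=> x; rewrite /= in_itv/= => /andP[ex x1]; have x0 := lt_le_trans e0 ex.
    rewrite lee_fin (powR_inv1 (ltW x0)) ler_pdivrMr// [leRHS]mulrC /gamma_kernel mulrA.
    rewrite (gt0_mulr_powRB1 _ b x0) mulr1.
    by rewrite ler_pM ?expR_ge0 ?kx ?ex// ler_expR lerN2.
have [d1 _] := is_derive1_powR (- 1) (lt_le_trans e0 ex).
exact: derivableM (derivable_cst (k * expR (- 1)) x 1) d1.
Qed.

Lemma gamma_integral_gt0 {R : realType} (b : R) : 0 < b ->
  (0 < gamma_integral b 1)%E.
Proof.
move=> b0; have e01 : 0 < (2^-1 : R) < 1 by rewrite invr_gt0 invf_lt1// ltr1n andbT.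
apply: lt_le_trans (gamma_integral_ge b 2^-1 (2^-1 `^ b) e01 (powR_ge0 _ _) _).
by rewrite lte_fin lnV ?posrE// opprK !mulr_gt0 ?powR_gt0 ?expR_gt0 ?ln_gt0 ?ltr1n.
move=> x /andP[ex _]; have h0 : 0 <= (2^-1 : R) by rewrite invr_ge0.
by apply: ge0_ler_powR; rewrite ?nnegrE//; [exact: ltW|exact: le_trans ex].
Qed.

Lemma gamma_integral_pinfty {R : realType} (b : R) : b <= 0 ->
  gamma_integral b 1 = +oo%E.
Proof.
move=> b0; apply/eqyP => A A0.
(* This e makes the logarithmic lower bound equal to A. *)
pose e : R := expR (- (expR 1 * A)).
have e01 : 0 < e < 1 by rewrite expR_gt0 expR_lt1 oppr_lt0 mulr_gt0 ?expR_gt0.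
have := gamma_integral_ge b e 1 e01 ler01.
rewrite expRK opprK mul1r mulrA -expRD addNr expR0 mul1r; apply => x /andP[ex x1].
rewrite -(powRr0 x); apply: ger_powR => //; rewrite x1 andbT.
by case/andP : e01 => e0 _; rewrite (lt_le_trans e0).
Qed.

Lemma gamma_integral1 {R : realType} (b : R) : 0 < b ->
  gamma_integral b 1 = (Gamma b)%:E.
Proof.
move=> b0; rewrite /Gamma b0 /Euler_integral /Rintegral.
under eq_integral do rewrite -[X in expR (- X)]mulr1.
by rewrite fineK// ge0_fin_numE ?gamma_integral_ge0 ?gamma_integral_lty.
Qed.

(** * The Dirichlet series of zeta *)

(** A discrete form of the primitive of y ^ (- t): writing y = x + 1, one has
    (x / y) ^ (1 - t) = exp ((t - 1) * ln (y / x)) >= 1 + (t - 1) / y, because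
    ln (x / y) = ln (1 - 1 / y) <= - 1 / y; it remains to multiply by
    y ^ (1 - t). *)
Lemma powR_telescope {R : realType} (t x : R) : 1 < t -> 0 < x ->
  (t - 1) * (x + 1) `^ (- t) <= x `^ (1 - t) - (x + 1) `^ (1 - t).
Proof.
move=> t1 x0; set y := x + 1; have y0 : 0 < y by rewrite addr_gt0.
have xy0 : 0 < x / y by rewrite divr_gt0.
have xE : x = y * (x / y) by rewrite mulrCA mulfV ?mulr1// gt_eqF.
have -> : x `^ (1 - t) = y `^ (1 - t) * (x / y) `^ (1 - t).
  by rewrite {1}xE powRM// ltW.
have -> : y `^ (- t) = y `^ (1 - t) / y.
  rewrite -(gt0_mulr_powRB1 _ (1 - t) y0) mulrAC mulfV ?mul1r ?gt_eqF//.
  by congr (_ `^ _); ring.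
rewrite -[X in _ <= _ - X]mulr1 -mulrBr mulrCA ler_wpM2l ?powR_ge0//.
have lnxy : ln (x / y) <= - y^-1.
  have -> : x / y = 1 + - y^-1 by rewrite /y; field; rewrite gt_eqF.
  by apply: le_ln1Dx; rewrite ltrN2 invf_lt1// ltrDr.
have -> : (x / y) `^ (1 - t) = expR ((1 - t) * ln (x / y)).
  by rewrite /powR gt_eqF.
rewrite lerBrDr; apply: le_trans (expR_ge1Dx _); rewrite addrC lerD2l.
by rewrite -(opprB t 1) mulNr -mulrN ler_wpM2l ?subr_ge0 ?(ltW t1)// lerNr.
Qed.

Lemma cvg_dirichlet_series {R : realType} (t : R) : 1 < t ->
  cvgn (series (fun n => n.+1%:R `^ (- t) : R)).
Proof.
move=> t1; have t0 : 0 < t - 1 by rewrite subr_gt0.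
set u := fun n => _; have u0 n : 0 <= u n by exact: powR_ge0.
(* The first term is 1 and the following ones telescope. *)
have bnd n : series u n.+1 <= 1 + (t - 1)^-1 * (1 - n.+1%:R `^ (1 - t)).
  elim: n => [|n ih].
    by rewrite /series/= big_nat1 /u !powR1 subrr mulr0 addr0.
  rewrite seriesSr; apply: le_trans (lerD ih (lexx _)) _.
  rewrite -addrA lerD2l -lerBrDl -mulrBr.
  rewrite mulrC ler_pdivlMr// mulrC.
  have := powR_telescope t n.+1%:R t1 (ltr0Sn _ _).
  rewrite natr1 => /le_trans; apply.
  by lra.
apply: nondecreasing_is_cvgn.
  by apply: nondecreasing_series => n _ _; exact: u0.
exists (1 + (t - 1)^-1) => _ [n _ <-].
apply: (@le_trans _ _ (series u n.+1)).
  by rewrite seriesSr lerDl.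
apply: le_trans (bnd n) _; rewrite lerD2l -[leRHS]mulr1.
by rewrite ler_wpM2l ?invr_ge0 ?(ltW t0)// lerBlDr lerDl powR_ge0.
Qed.

Lemma nneseries_zeta {R : realType} (t : R) : 1 < t ->
  (\sum_(0 <= n <oo) (n.+1%:R `^ (- t))%:E)%E = (zeta t)%:E.
Proof.
move=> t1; rewrite /zeta t1 -EFin_lim; last exact: cvg_dirichlet_series.
by apply: congr_lim; apply/funext => n /=; rewrite sumEFin.
Qed.

(** The terms dominate those of the harmonic series. *)
Lemma nneseries_dirichlet_pinfty {R : realType} (t : R) : t <= 1 ->
  (\sum_(0 <= n <oo) (n.+1%:R `^ (- t) : R)%:E)%E = +oo%E.
Proof.
move=> t1; set u := fun n => n.+1%:R `^ (- t) : R.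
have u0 n : 0 <= u n by exact: powR_ge0.
have dvg_u : ~ cvgn (series u).
  move=> cu; apply: (@dvg_harmonic R); apply: (series_le_cvg harmonic_ge0 u0 _ cu).
  move=> n; rewrite /u /= -powR_inv1//.
  by apply: ler_powR; rewrite ?ler1n// lerN2.
have := nondecreasing_dvgn_lt (nondecreasing_series (fun n _ _ => u0 n)) dvg_u.
move=> /cvgeryP /cvg_lim <-//.
by apply: congr_lim; apply/funext => n /=; rewrite sumEFin.
Qed.

(** * Integration term by term *)

(** Monotone convergence: all terms are nonnegative, and both sides may be
    +oo. *)
Lemma integral_dirichlet_expR {R : realType} (b a : R) :
  (\int[lebesgue_measure]_(x in `]0%R, +oo[)
     ((x `^ (b - 1))%:E *
      \sum_(1 <= j <oo) (expR (- (x * j%:R `^ a)))%:E) =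
   \sum_(0 <= n <oo) gamma_integral b (n.+1%:R `^ a))%E.
Proof.
rewrite -integral_nneseries//; last 2 first.
- move=> n; apply/measurable_EFinP/measurable_funTS.
  exact: measurable_gamma_kernel.
- by move=> n x _; rewrite lee_fin gamma_kernel_ge0.
apply: eq_integral => x _.
rewrite -nneseries_addn => [|i]; last by rewrite lee_fin expR_ge0.
rewrite -nneseriesZl => [|i _]; last by rewrite lee_fin expR_ge0.
by apply: eq_eseriesr => n _; rewrite addn1.
Qed.

Lemma nneseries_gamma_integral {R : realType} (b a : R) : 0 < b ->
  (\sum_(0 <= n <oo) gamma_integral b (n.+1%:R `^ a) =
   (Gamma b)%:E * \sum_(0 <= n <oo) (n.+1%:R `^ (- (a * b)))%:E)%E.
Proof.
move=> b0; rewrite -nneseriesZl => [|n _]; last by rewrite lee_fin powR_ge0.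
apply: eq_eseriesr => n _; rewrite gamma_integral_scale ?powR_gt0//.
by rewrite gamma_integral1// -powRrM mulrN muleC.
Qed.

(** * The integral representation *)

Theorem mainTheorem7 (R : realType) (s b : R) :
  [/\ s < 0, 0 < b & 1 < - b * s] <->
  ((zeta (- b * s) * Gamma b)%:E =
   \int[lebesgue_measure]_(x in `]0%R, +oo[)
     ((x `^ (b - 1))%:E *
      \sum_(1 <= j <oo) (expR (- (x * j%:R `^ (- s))))%:E))%E.
Proof.
have tE : - (- s * b) = - (- b * s) by ring.
rewrite integral_dirichlet_expR; split.
  move=> [s0 b0 t1].
  by rewrite nneseries_gamma_integral// tE nneseries_zeta// -EFinM mulrC.
move=> int_fin; have [b0|b0] := leP b 0.
  suff : (+oo <= (zeta (- b * s) * Gamma b)%:E)%E by rewrite leye_eq.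
  rewrite int_fin.
  have := @nneseries_lim_ge R _ xpredT 0 1
    (fun n _ _ => gamma_integral_ge0 b (n.+1%:R `^ (- s))).
  by rewrite big_nat1 powR1 gamma_integral_pinfty.
move: int_fin; rewrite nneseries_gamma_integral// tE.
have [t1|t1 _] := leP (- b * s) 1; last first.
  split => //; have := lt_trans ltr01 t1.
  by rewrite mulNr -mulrN pmulr_rgt0// oppr_gt0.
rewrite nneseries_dirichlet_pinfty// gt0_muley//.
by rewrite -gamma_integral1// gamma_integral_gt0.
Qed.
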